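(* Let $G$ be a connected graph with $\delta(G)\geq 2$, and put \[ B=\{v\in V(G):d_G(v)\geq 3\}. \] Then $G\in\mathcal F$ if and only if $G[B]$ is a forest.
   Context: All graphs are finite and simple; $\delta(G)$ is the minimum degree, $d_G(v)$ the degree of $v$, and $G[B]$ the subgraph induced by $B$ (the empty graph counts as a forest). A connected vertex cover of $G$ is a set of vertices that meets every edge and induces a connected subgraph; $cvc(G)$ is the minimum size of a connected vertex cover. $\mathcal F$ is the class of connected graphs $G$ with $\delta(G)\ge 2$ such that $cvc(G)=2|V(G)|-|E(G)|-1$. *)

(* Defs.v *)
From mathcomp Require Import all_boot ssralg ssrnum ssrint.

Set Implicit Arguments.
Unset Strict Implicit.
Unset Printing Implicit Defensive.

Record sgraph := SGraph {
  vertex :> finType;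
  adj : rel vertex;
  adj_sym : symmetric adj;
  adj_irr : irreflexive adj
}.

Definition deg (G : sgraph) (v : G) : nat := #|[set w | adj v w]|.

(* The default value #|G| exceeds every degree, so it is neutral as soon as
   the graph has a vertex. *)
Definition mindeg (G : sgraph) : nat := \big[minn/#|G|]_(v : G) deg v.

Definition edges (G : sgraph) : {set {set G}} :=
  [set e | [exists x, [exists y, adj x y && (e == [set x; y])]]].

Section Induced.
Variables (G : sgraph) (S : {set G}).

Definition induced_adj : rel {x : G | x \in S} :=
  fun x y => adj (val x) (val y).

Lemma induced_sym : symmetric induced_adj.
Proof. by move=> x y; apply: adj_sym. Qed.

Lemma induced_irr : irreflexive induced_adj.
Proof. by move=> x; apply: adj_irr. Qed.

Definition induced : sgraph := SGraph induced_sym induced_irr.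

End Induced.

(* The graph without vertices is not connected. *)
Definition connected (G : sgraph) : bool :=
  (0 < #|G|) && [forall x : G, forall y : G, connect (@adj G) x y].

(* The library's [cycle] accepts the closed walk x, y, x along a single edge,
   whence the lower bound on the length. *)
Definition graph_cycle (G : sgraph) (c : seq G) : bool :=
  [&& 2 < size c, uniq c & cycle (@adj G) c].

Definition forest (G : sgraph) : Prop :=
  forall c : seq G, ~~ graph_cycle c.

Definition vertex_cover (G : sgraph) (S : {set G}) : bool :=
  [forall e in edges G, S :&: e != set0].

Definition connected_vertex_cover (G : sgraph) (S : {set G}) : bool :=
  vertex_cover S && connected (induced S).

(* In a connected graph the starting point [set: G] is itself a connected
   vertex cover, so the minimum is attained. *)
Definition cvc (G : sgraph) : nat :=
  #|[arg min_(S < [set: G] | connected_vertex_cover S) #|S|]|.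

(* The right-hand side is computed in [int] because natural-number subtraction
   truncates. *)
Definition class_F (G : sgraph) : Prop :=
  [/\ connected G, 2 <= mindeg G &
      ((cvc G)%:Z = 2 * #|G|%:Z - #|edges G|%:Z - 1)%R].

(* Main.v *)
Require Import Defs.
From mathcomp Require Import all_boot.
From mathcomp Require Import zify.

Set Implicit Arguments.
Unset Strict Implicit.
Unset Printing Implicit Defensive.

(** Write [n] and [m] for the numbers of vertices and edges of [G], and let [S]
    be a connected vertex cover. The edges of [G] are of two kinds. Those inside
    [S] form a connected graph on [#|S|] vertices, so there are at least
    [#|S| - 1] of them, with equality exactly when [S] induces a tree. Since the
    complement of [S] is independent, the remaining edges are counted by the
    degrees of the vertices outside [S], so there are at least [2 * (n - #|S|)]
    of them, with equality exactly when all these vertices have degree two, that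
    is, when [B] lies in [S]. Adding up gives [#|S| >= 2 * n - m - 1], and the
    bound is tight exactly when [S] induces a tree and contains [B]
    ([card_connected_vertex_cover]).

    Hence [G] belongs to the class if and only if such an [S] exists. If it does,
    [B] induces a forest, being part of a tree. Conversely, assume that [B]
    induces a forest and take [S] smallest among the connected vertex covers that
    contain [B] ([forest_cover]). A cycle inside [S] would have to leave [B], hence
    to pass through a vertex of degree two. Both neighbours of this vertex are on
    the cycle, so they belong to [S] and stay connected by the rest of the cycle;
    deleting the vertex leaves a smaller connected vertex cover
    ([connected_cover_setD1]), contradicting the choice of [S].

    The statement about trees ([connected_leq_edges] and [connected_forestP])
    comes from a spanning tree given by a parent map: each vertex other than the
    root has an edge to its parent, and the graph is a forest exactly when it has
    no other edges. *)

(** * Edges, degrees and cycles *)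

Lemma edgesP (G : sgraph) (e : {set G}) :
  reflect (exists x y, adj x y /\ e = [set x; y]) (e \in edges G).
Proof.
rewrite inE; apply: (iffP existsP) => [[x /existsP[y /andP[xy /eqP->]]]|].
  by exists x, y.
by case=> x [y [xy ->]]; exists x; apply/existsP; exists y; rewrite xy eqxx.
Qed.

Lemma adj_neq (G : sgraph) (x y : G) : adj x y -> x != y.
Proof. by apply: contraTneq => ->; rewrite adj_irr. Qed.

Lemma set2_inj (T : finType) (x y z : T) : [set x; y] = [set x; z] -> y = z.
Proof.
move=> eq_e.
have /set2P[yx|//] : y \in [set x; z] by rewrite -eq_e set22.
have /set2P[zx|//] : z \in [set x; y] by rewrite eq_e set22.
by rewrite yx zx.
Qed.

Lemma mindeg_le (G : sgraph) (v : G) : mindeg G <= deg v.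
Proof.
rewrite /mindeg; elim: (index_enum G) (mem_index_enum v) => // u s IHs.
rewrite inE big_cons => /predU1P[<-|/IHs vs]; first exact: geq_minl.
by rewrite geq_min vs orbT.
Qed.

Lemma deg2_neighbours (G : sgraph) (v y z w : G) :
  deg v <= 2 -> y != z -> adj v y -> adj v z -> adj v w -> w \in [set y; z].
Proof.
move=> dv yz vy vz vw.
have /eqP-> : [set y; z] == [set u | adj v u].
  rewrite eqEcard cards2 yz dv andbT.
  by apply/subsetP => u /set2P[]->; rewrite inE.
by rewrite inE.
Qed.

(** Any vertex of a cycle may be taken as its first vertex; its two neighbours
    along the cycle are then the second and the last one. *)
Lemma graph_cycle_at (G : sgraph) (c : seq G) (x : G) :
  graph_cycle c -> x \in c ->
  exists y s z, graph_cycle (x :: y :: rcons s z) /\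
    {subset x :: y :: rcons s z <= c}.
Proof.
case/and3P=> sz un cy /rot_to[i s E].
have sub : {subset x :: s <= c} by move=> w; rewrite -E mem_rot.
move: sz un cy; rewrite -(size_rot i) -(rot_uniq i) -(rot_cycle i) E.
case: s sub {E} => [//|y s]; case/lastP: s => [//|s z] sub sz un cy.
by exists y, s, z; split=> //; apply/and3P.
Qed.

Lemma graph_cycle_homo (G H : sgraph) (f : G -> H) (c : seq G) :
  {in c &, injective f} -> {in c &, {homo f : x y / adj x y}} ->
  graph_cycle c -> graph_cycle (map f c).
Proof.
move=> inj_f hom_f /and3P[sz un cy].
rewrite /graph_cycle size_map sz map_inj_in_uniq ?un //=.
by apply: (homo_cycle_in hom_f) cy; apply/allP.
Qed.

Lemma forest_homo (G H : sgraph) (f : G -> H) :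
  injective f -> {homo f : x y / adj x y} -> forest H -> forest G.
Proof.
move=> inj_f hom_f forH c; apply: contra (forH (map f c)).
by apply: graph_cycle_homo => x y _ _; [apply: inj_f | apply: hom_f].
Qed.

Lemma connect_homo (T U : finType) (e : rel T) (e' : rel U) (f : T -> U) :
  (forall x y, e x y -> connect e' (f x) (f y)) ->
  forall x y, connect e x y -> connect e' (f x) (f y).
Proof.
move=> hom_f x y /connectP[p]; elim: p x => [|z p IHp] x /=; first by move=> _ ->.
by case/andP=> /hom_f xz zp /(IHp z zp); apply: connect_trans.
Qed.

(** * Spanning trees and the number of edges *)

(** A spanning tree with root [r]. Along parents the rank [d] decreases, which
    excludes cycles and makes every chain of parents end at [r]. *)
Definition parent_map (G : sgraph) (r : G) (p : G -> G) (d : G -> nat) :=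
  forall v, v != r -> adj v (p v) /\ d (p v) < d v.

(** Take for [d] the distance to [r], and for [p] the predecessor on a shortest
    path from [r]. *)
Lemma connected_parent_map (G : sgraph) (r : G) :
  connected G -> exists p d, parent_map r p d.
Proof.
case/andP=> _ /forallP/(_ r)/forallP conn_r.
pose walk v n := [exists t : n.-tuple G, path (@adj G) r t && (last r t == v)].
have walkP v s : path (@adj G) r s -> v = last r s -> walk v (size s).
  by move=> rs ->; apply/existsP; exists (in_tuple s); rewrite rs eqxx.
have ex_walk v : exists n, walk v n.
  by have /connectP[s rs vs] := conn_r v; exists (size s); apply: walkP.
pose d v := ex_minn (ex_walk v).
have pred_ex v : v != r -> exists u, adj v u && (d u < d v).
  move=> vr; rewrite {2}/d; case: ex_minnP => n /existsP[t /andP[]] + + _.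
  have := size_tuple t; case/lastP: (val t) => [|s w] /=.
    by move=> _ _ /eqP rv; rewrite rv eqxx in vr.
  rewrite size_rcons rcons_path last_rcons => <- /andP[rs sw] /eqP<-.
  exists (last r s); rewrite adj_sym sw /= ltnS /d.
  by case: ex_minnP => m _; apply; apply: walkP.
exists (fun v => odflt v [pick u | adj v u && (d u < d v)]), d => v /pred_ex[u uP].
by case: pickP => [w /andP//|/(_ u)]; rewrite uP.
Qed.

Section ParentEdges.
Variables (G : sgraph) (r : G) (p : G -> G) (d : G -> nat).
Hypothesis p_parent : parent_map r p d.

Definition parent_edges : {set {set G}} := [set [set v; p v] | v in [set~ r]].

Lemma parent_edges_sub : parent_edges \subset edges G.
Proof.
apply/subsetP => e /imsetP[v + ->]; rewrite in_setC1 => /p_parent[vp _].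
by apply/edgesP; exists v, (p v).
Qed.

(** If two vertices had the same parent edge, each would be the parent of the
    other, hence strictly closer to the root than the other. *)
Lemma card_parent_edges : #|parent_edges|.+1 = #|G|.
Proof.
rewrite card_in_imset; last first.
  move=> v w; rewrite !inE => /p_parent[_ dv] /p_parent[_ dw] eq_e.
  have /set2P[//|vw] : v \in [set w; p w] by rewrite -eq_e set21.
  have /set2P[//|wv] : w \in [set v; p v] by rewrite eq_e set21.
  by move: dv dw; rewrite -vw -wv; lia.
by rewrite cardsC1 prednK //; apply/card_gt0P; exists r.
Qed.

(** A vertex of a cycle farthest from the root is not the parent of a cycle
    neighbour, so both cycle edges at it would have to lead to its own parent. *)
Lemma parent_edges_forest : edges G \subset parent_edges -> forest G.
Proof.
move=> /subsetP sub c; apply/negP => cyc.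
have [x0 x0c] : exists x, x \in c.
  by case: c cyc => [|x c] // _; exists x; rewrite mem_head.
have [x xc x_max] : exists2 x, x \in c & forall y, y \in c -> d y <= d x.
  by case: (arg_maxnP d x0c) => x; exists x.
have to_parent y : y \in c -> adj x y -> y = p x.
  move=> yc xy.
  have /imsetP[v] : [set x; y] \in parent_edges.
    by apply: sub; apply/edgesP; exists x, y.
  rewrite !inE => /p_parent[_ dv] eq_e.
  have /set2P[vx|vy] : v \in [set x; y] by rewrite eq_e set21.
    by rewrite vx in eq_e; apply: set2_inj eq_e.
  rewrite vy setUC in eq_e dv; have := x_max y yc.
  by rewrite leqNgt (set2_inj eq_e) dv.
have [y [s [z [/and3P[_ un cy] sub_c]]]] := graph_cycle_at cyc xc.
have [xy zx] : adj x y /\ adj z x.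
  by move: cy; rewrite (cycle_path x) /= last_rcons => /and3P[zx xy _].
have yz : y = z.
  have -> : y = p x by apply: to_parent xy; apply: sub_c; rewrite !inE eqxx orbT.
  apply/esym/to_parent; last by rewrite adj_sym.
  by apply: sub_c; rewrite !inE mem_rcons mem_head !orbT.
by move: un; rewrite yz cons_uniq cons_uniq mem_rcons mem_head andbF.
Qed.

(** An edge [xy] that is not a parent edge closes a cycle with the path that
    joins its ends through the root along parent edges. *)
Lemma forest_parent_edges : forest G -> edges G \subset parent_edges.
Proof.
move=> forG; apply/subsetP => e /edgesP[x [y [xy ->]]].
apply: contraT => not_parent.
(* The parent edges all avoid [xy], so [G] minus this edge is connected. *)
pose e' := [rel a b | adj a b && ([set a; b] != [set x; y])].
have to_root v : connect e' v r.
  have [n] := ubnP (d v); elim: n v => // n IHn v dv.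
  have [->|vr] := eqVneq v r; first exact: connect0.
  have [vp dp] := p_parent vr.
  apply: connect_trans (IHn (p v) (leq_trans dp dv)); apply: connect1.
  rewrite /= vp; apply: contraNneq not_parent => <-.
  by apply: imset_f; rewrite in_setC1.
have sym_e' : connect_sym e'.
  by apply: sym_connect_sym => a b /=; rewrite adj_sym setUC.
have /connectP[q0 q0P y_last] : connect e' x y.
  by apply: connect_trans (to_root x) _; rewrite sym_e'.
move: y_last; case/shortenP: q0P => q qP un _ y_last.
have /negP[] := forG (x :: q); apply/and3P; split=> //.
  case: q qP y_last {un} => [|a [|b q]] //=.
    by move=> _ yx; rewrite yx adj_irr in xy.
  by move=> /andP[/andP[_ +] _] ya; rewrite -ya eqxx.
rewrite (cycle_path x) /= -y_last adj_sym xy /=.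
by apply: sub_path qP => a b /andP[].
Qed.

End ParentEdges.

Lemma connected_leq_edges (G : sgraph) : connected G -> #|G| <= #|edges G|.+1.
Proof.
move=> conn; have /andP[/card_gt0P[r _] _] := conn.
have [p [d pP]] := connected_parent_map r conn.
by rewrite -(card_parent_edges pP) ltnS subset_leq_card ?(parent_edges_sub pP).
Qed.

Lemma connected_forestP (G : sgraph) :
  connected G -> forest G <-> #|edges G|.+1 = #|G|.
Proof.
move=> conn; have /andP[/card_gt0P[r _] _] := conn.
have [p [d pP]] := connected_parent_map r conn.
have sub := parent_edges_sub pP; rewrite -(card_parent_edges pP).
split=> [/(forest_parent_edges pP) sup | [le_card]].
  by congr _.+1; apply: eq_card; apply/subset_eqP; rewrite sup sub.
apply: (parent_edges_forest pP).
suff /eqP-> : parent_edges r p == edges G by [].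
by rewrite eqEcard sub le_card leqnn.
Qed.

(** * Vertex covers *)

Lemma vertex_coverP (G : sgraph) (S : {set G}) :
  reflect (forall x y, adj x y -> x \notin S -> y \in S) (vertex_cover S).
Proof.
apply: (iffP forall_inP) => [cov x y xy xS | cov e /edgesP[x [y [xy ->]]]].
  have /set0Pn[z] : S :&: [set x; y] != set0 by apply: cov; apply/edgesP; exists x, y.
  by rewrite !inE => /andP[zS /pred2P[]zE]; [rewrite -zE zS in xS | rewrite -zE].
apply/set0Pn; have [xS|/(cov x y xy) yS] := boolP (x \in S).
  by exists x; rewrite !inE xS eqxx.
by exists y; rewrite !inE yS eqxx orbT.
Qed.

Lemma card_induced (G : sgraph) (S : {set G}) : #|induced S| = #|S|.
Proof. exact: card_sig. Qed.

Lemma card_edges_induced (G : sgraph) (S : {set G}) :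
  #|edges (induced S)| = #|[set e in edges G | e \subset S]|.
Proof.
rewrite -(card_imset _ (imset_inj (@val_inj _ _ (induced S)))).
apply: eq_card => e; rewrite inE.
apply/imsetP/andP => [[e' /edgesP[x [y [xy ->]]] ->] | [/edgesP[x [y [xy ->]]]]].
  rewrite imsetU !imset_set1; split; first by apply/edgesP; exists (val x), (val y).
  by apply/subsetP => z /set2P[]->; apply: valP.
rewrite subUset !sub1set => /andP[xS yS].
pose x' : induced S := Sub x xS; pose y' : induced S := Sub y yS.
exists [set x'; y']; last by rewrite imsetU !imset_set1.
by apply/edgesP; exists x', y'.
Qed.

(** Each edge outside the cover has exactly one end outside it, so these edges
    are counted by the degrees of the vertices outside the cover. *)
Lemma card_edges_cover (G : sgraph) (S : {set G}) :
  vertex_cover S -> #|edges G| = #|edges (induced S)| + \sum_(v in ~: S) deg v.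
Proof.
move=> /vertex_coverP cov; rewrite card_edges_induced.
rewrite -(cardsID [set e : {set G} | e \subset S]) setIdE; congr (_ + _).
(* Count the incidences between uncovered vertices and these edges: a vertex
   lies on as many of them as its degree, each edge has one uncovered end. *)
have degE v : v \in ~: S ->
    deg v = \sum_(e in edges G :\: [set e : {set G} | e \subset S]) (v \in e).
  rewrite inE => vS.
  rewrite (eq_bigr (fun e : {set G} => if v \in e then 1 else 0)); last first.
    by move=> e _; case: (v \in e).
  rewrite -big_mkcondr sum1dep_card /deg -(card_imset _ (@set2_inj _ v)).
  apply: eq_card => e; rewrite in_set in_setD [e \in [set _ | _]]inE.
  apply/imsetP/idP => [[w]|].
    rewrite inE => vw ->; rewrite set21 subUset sub1set (negPf vS) /= andbT.
    by apply/edgesP; exists v, w.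
  case/andP=> /andP[_ /edgesP[x [y [xy ->]]]] /set2P[]->; first by exists y; rewrite ?inE.
  by exists x; rewrite ?inE 1?adj_sym // setUC.
rewrite (eq_bigr _ degE) exchange_big /= -sum1_card; apply: eq_bigr => e.
rewrite in_setD inE => /andP[eS /edgesP[x [y [xy eE]]]].
wlog xS : x y xy eE / x \notin S.
  move=> IH; have [xS|] := boolP (x \in S); last exact: IH xy eE.
  apply: (IH y x); rewrite 1?adj_sym 1?setUC //.
  by apply: contra eS => yS; rewrite eE subUset !sub1set xS.
rewrite (bigD1 x) ?inE //= eE set21 big1 ?addn0 // => z /andP[zS zx].
rewrite !inE (negPf zx) /=; case: eqP zS => // ->.
by rewrite inE (cov x y).
Qed.

(** * Connected vertex covers *)

(** A retraction of the larger graph onto the smaller one that sends adjacent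
    vertices to connected ones turns walks into walks. *)
Lemma connected_induced_sub (G : sgraph) (S T : {set G}) (f : induced S -> induced T) :
  (forall x, val x \in T -> val (f x) = val x) -> T \subset S ->
  (forall x y, adj x y -> connect (@adj (induced T)) (f x) (f y)) ->
  connected (induced S) -> connected (induced T).
Proof.
move=> fK /subsetP TS hom_f /andP[/card_gt0P[s _] conn]; apply/andP; split.
  by apply/card_gt0P; exists (f s).
pose g (x : induced T) : induced S := Sub (val x) (TS _ (valP x)).
have gK : cancel g f by move=> x; apply: val_inj; rewrite fK ?SubK ?(valP x).
apply/forallP => x; apply/forallP => y; rewrite -(gK x) -(gK y).
by apply: (connect_homo hom_f); move/forallP/(_ (g x))/forallP: conn; apply.
Qed.

(** The two cycle neighbours of [v] are its only neighbours. They belong to [S],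
    so the edges at [v] stay covered, and the rest of the cycle still joins them,
    so any walk in [S] can bypass [v]. *)
Lemma connected_cover_setD1 (G : sgraph) (S : {set G}) (c : seq (induced S)) v :
  connected_vertex_cover S -> graph_cycle c -> v \in c -> deg (val v) <= 2 ->
  connected_vertex_cover (S :\ val v).
Proof.
move=> /andP[/vertex_coverP cov conn] cyc vc dv.
have [y [s [z [/and3P[_ un cy] _]]]] := graph_cycle_at cyc vc.
have [vy vz ysz] : [/\ adj v y, adj v z & path (@adj (induced S)) y (rcons s z)].
  move: cy; rewrite (cycle_path v) [last _ _]/= last_rcons => /and3P[zv vy yz].
  by split=> //; rewrite adj_sym.
move: un; rewrite cons_uniq => /andP[v_ysz].
rewrite cons_uniq mem_rcons inE negb_or => /andP[/andP[yz _] _].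
have nbr w : adj (val v) w -> w \in [set val y; val z].
  by apply: (deg2_neighbours dv).
have nvD (w : induced S) : w != v -> val w \in S :\ val v.
  by move=> wv; rewrite !inE wv (valP w).
have vP (w : induced S) : adj v w -> w != v.
  by move=> vw; rewrite eq_sym (adj_neq vw).
apply/andP; split.
  apply/vertex_coverP => a b ab; rewrite !inE negb_and negbK.
  have inS w : adj (val v) w -> (w != val v) && (w \in S).
    move=> vw; rewrite eq_sym (adj_neq vw).
    by case/set2P: (nbr w vw) => ->; apply: valP.
  case/orP=> [/eqP av|aS]; first by apply: inS; rewrite -av.
  have bS := cov a b ab aS; rewrite bS andbT; apply: contraNneq aS => bv.
  by have /andP[] : (a != val v) && (a \in S) by apply: inS; rewrite -bv adj_sym.
pose D := S :\ val v.
pose y' : induced D := Sub (val y) (nvD y (vP y vy)).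
(* [f] fixes every vertex but [v], which it sends to its neighbour [y]. *)
pose f (w : induced S) : induced D := insubd y' (val w).
have fE (w : induced S) : w != v -> val (f w) = val w.
  by move=> wv; rewrite val_insubd nvD.
have fv : f v = y' by apply: val_inj; rewrite val_insubd !inE eqxx.
have f_adj (a b : induced S) : a != v -> b != v -> adj a b -> adj (f a) (f b).
  by move=> av bv ab; rewrite /adj /= /induced_adj !fE.
have yz' : connect (@adj (induced D)) (f y) (f z).
  apply/connectP; exists (map f (rcons s z)); last by rewrite last_map last_rcons.
  rewrite path_map; apply: (sub_in_path (P := predC1 v)) ysz.
    by move=> a b av bv; apply: f_adj.
  by rewrite all_predC has_pred1.
have to_v (a : induced S) : adj v a -> connect (@adj (induced D)) (f v) (f a).
  move=> va; have -> : f v = f y by rewrite fv; apply: val_inj; rewrite fE // vP.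
  by case/set2P: (nbr (val a) va) => /val_inj->.
apply: (connected_induced_sub (f := f)) conn; last 1 first.
- move=> a b ab; have [av|av] := eqVneq a v; first by rewrite av in ab *; apply: to_v.
  have [bv|bv] := eqVneq b v; last exact: connect1 (f_adj a b av bv ab).
  rewrite bv in ab *; rewrite (sym_connect_sym (@adj_sym _)); apply: to_v.
  by rewrite adj_sym.
- by move=> a; rewrite !inE => /andP[av _]; apply: fE.
- exact: subD1set.
Qed.

Lemma connected_vertex_cover_setT (G : sgraph) :
  connected G -> connected_vertex_cover [set: G].
Proof.
move=> /andP[G0 conn]; apply/andP; split; first by apply/vertex_coverP => x y; rewrite inE.
apply/andP; split; first by rewrite card_induced cardsT.
apply/forallP => x; apply/forallP => y.
pose f (z : G) : induced [set: G] := Sub z (in_setT z).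
have fK z : f (val z) = z by apply: val_inj.
rewrite -(fK x) -(fK y).
apply: (connect_homo (e := @adj G)) => [a b ab|]; first exact: connect1.
by move/forallP/(_ (val x))/forallP: conn; apply.
Qed.

(** The degree bound on the edges leaving the cover is tight when all vertices
    outside it have degree two, and the bound on the edges inside it when they
    form a tree. *)
Lemma card_connected_vertex_cover (G : sgraph) (S : {set G}) :
  2 <= mindeg G -> connected_vertex_cover S ->
  2 * #|G| <= (#|S| + #|edges G|).+1 /\
  (2 * #|G| = (#|S| + #|edges G|).+1 <->
     forest (induced S) /\ [set v | 3 <= deg v] \subset S).
Proof.
move=> hdeg /andP[cov conn].
have eq_m := card_edges_cover cov.
have le_S := connected_leq_edges conn; rewrite card_induced in le_S.
have [deg_eq] : 2 * #|~: S| <= \sum_(v in ~: S) deg v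
    ?= iff [forall (v | v \in ~: S), 2 == deg v].
  rewrite mulnC -sum_nat_const; apply: leqif_sum => v _.
  by split=> //; apply: leq_trans hdeg (mindeg_le v).
have -> : [forall (v | v \in ~: S), 2 == deg v] = ([set v | 3 <= deg v] \subset S).
  apply/forall_inP/subsetP => [deg2 v | sub v].
    rewrite inE; apply: contraTT => vS; rewrite -(eqP (deg2 v _)) //.
    by rewrite inE.
  rewrite inE; apply: contraR => dv; apply: sub.
  by rewrite inE ltn_neqAle dv (leq_trans hdeg (mindeg_le v)).
have S_n := cardsC S; rewrite (connected_forestP conn) card_induced => eq_deg.
split; first by lia.
by rewrite -eq_deg; split=> [|[? /eqP]]; [split; first lia; apply/eqP|]; lia.
Qed.

Lemma cvcP (G : sgraph) : connected G ->
  exists2 S : {set G}, connected_vertex_cover S /\ cvc G = #|S| &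
    forall T : {set G}, connected_vertex_cover T -> cvc G <= #|T|.
Proof.
move=> /connected_vertex_cover_setT cov; rewrite /cvc.
by case: (arg_minnP (fun S : {set G} => #|S|) cov) => S covS min_S; exists S.
Qed.

(** Take a smallest connected vertex cover among those containing [B]. A cycle
    inside it would contain a vertex outside [B], as [B] induces a forest; this
    vertex has degree at most two, and deleting it would give a smaller cover. *)
Lemma forest_cover (G : sgraph) (B : {set G}) :
  connected G -> [set v | 3 <= deg v] \subset B -> forest (induced B) ->
  exists S : {set G},
    [/\ connected_vertex_cover S, B \subset S & forest (induced S)].
Proof.
move=> /connected_vertex_cover_setT covT /subsetP degB forB.
pose P (S : {set G}) := connected_vertex_cover S && (B \subset S).
have PT : P [set: G] by rewrite /P covT subsetT.
case: (arg_minnP (fun S : {set G} => #|S|) PT) => S /andP[covS BS] min_S.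
exists S; split=> // c; apply/negP => cyc.
have [/allP cB|/allPn[v vc vB]] := boolP (all (fun x => val x \in B) c); last first.
  have dv : deg (val v) <= 2.
    by rewrite leqNgt; apply: contra vB => dv; apply: degB; rewrite inE.
  have := min_S (S :\ val v); rewrite /P (connected_cover_setD1 covS cyc vc dv).
  by rewrite subsetD1 BS vB [#|S|](cardsD1 (val v)) (valP v) ltnn => /(_ isT).
(* The cycle is now inside [B]; its first vertex serves as default value. *)
case: c cyc cB => // x0 c cyc cB.
have x0B : val x0 \in B by apply: cB; rewrite mem_head.
pose f (x : induced S) : induced B := insubd (Sub (val x0) x0B) (val x).
have /negP[] := forB (map f (x0 :: c)).
have fE x : x \in x0 :: c -> val (f x) = val x by move=> /cB xB; rewrite val_insubd xB.
apply: graph_cycle_homo cyc => [x y /fE fx /fE fy fxy|x y /fE fx /fE fy xy].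
  by apply: val_inj; rewrite -fx -fy fxy.
by rewrite /adj /= /induced_adj fx fy.
Qed.

Theorem proposition1 (G : sgraph) (hconn : connected G) (hdeg : 2 <= mindeg G) :
  let B : {set G} := [set v : G | 3 <= deg v] in
  class_F G <-> forest (induced B).
Proof.
move=> B; have [S [covS cvcE] min_cvc] := cvcP hconn; split.
  case=> _ _ eq_cvc.
  have [_ tight] := card_connected_vertex_cover hdeg covS.
  have [|forS BS] := tight.1; first by lia.
  pose f (x : induced B) : induced S := Sub (val x) (subsetP BS _ (valP x)).
  apply: (forest_homo (f := f)) forS => [x y|x y //].
  by move/(congr1 val); rewrite !SubK; apply: val_inj.
move=> forB; split=> //.
have [T [covT BT forT]] := forest_cover hconn (subxx B) forB.
have [_ [_ /(_ (conj forT BT))]] := card_connected_vertex_cover hdeg covT.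
have [+ _] := card_connected_vertex_cover hdeg covS.
by have := min_cvc T covT; rewrite cvcE; lia.
Qed.
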